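(* For all integers $k \geq 3$ and $d \geq 2$, $$\gamma_d(k) \leq \frac{2}{k} - \frac{1}{4k^4}.$$ Furthermore, for every $d \geq 2$: $\gamma_d(3) \leq 0.644$, $\gamma_d(4) \leq 0.494$, $\gamma_d(5) \leq 0.398$, $\gamma_d(6) \leq 0.333$, $\gamma_d(7) \leq 0.285$, $\gamma_d(8) \leq 0.250$, $\gamma_d(9) \leq 0.222$, and $\gamma_d(10) \leq 0.200$.
   Context: For a closed curve $C$ in $\mathbb{R}^d$, $w(C)$ denotes its length. For a non-empty subset $S$ of $C$, $w(S)$ denotes the length of the shortest closed curve in $\mathbb{R}^d$ containing $S$. $P_k(C)$ denotes the set of all partitions of $C$ into $k$ non-empty (not necessarily connected) sets. Define $$\gamma(C,k) = \min_{\mathcal{S}\in P_k(C)} \frac{\max_{S\in\mathcal{S}} w(S)}{w(C)}, \qquad \gamma_d(k) = \sup_{C \text{ in } \mathbb{R}^d} \gamma(C,k),$$ where the supremum is over all closed curves $C$ in $\mathbb{R}^d$. *)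

(* Defs.v *)
From mathcomp Require Import all_boot all_order all_algebra.
From mathcomp Require Import all_classical all_reals all_analysis.
Import Order.TTheory GRing.Theory Num.Theory.
Import numFieldNormedType.Exports.

Set Implicit Arguments.
Unset Strict Implicit.
Unset Printing Implicit Defensive.

Local Open Scope classical_set_scope.
Local Open Scope ring_scope.

(* The norm carried by 'rV[R]_d in the library is the sup norm, hence an
   explicit Euclidean distance; both induce the same topology. *)
Definition eucl_dist (R : realType) (d : nat) (x y : 'rV[R]_d) : R :=
  Num.sqrt (\sum_(i < d) (x ord0 i - y ord0 i) ^+ 2).

Definition closed_curve (R : realType) (d : nat) (c : R -> 'rV[R]_d) : Prop :=
  {within `[0, 1], continuous c} /\ c 0 = c 1.

Definition trace (R : realType) (d : nat) (c : R -> 'rV[R]_d) : set 'rV[R]_d :=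
  c @` `[0, 1].

(* [s] lists the subdivision points after 0, the last one being 1. *)
Definition polygonal_length (R : realType) (d : nat) (c : R -> 'rV[R]_d)
    (s : seq R) : R :=
  \sum_(0 <= i < size s)
    eucl_dist (c (nth 1 (0 :: s) i)) (c (nth 1 (0 :: s) i.+1)).

(* Length with multiplicity of the parametrized curve; +oo if not
   rectifiable. *)
Definition curve_length (R : realType) (d : nat) (c : R -> 'rV[R]_d) : \bar R :=
  ereal_sup [set (polygonal_length c s)%:E | s in itv_partition 0 1].

(* The infimum is attained, by compactness, as soon as it is finite. Constant
   curves are allowed, so a singleton has value 0. *)
Definition tour_length (R : realType) (d : nat) (S : set 'rV[R]_d) : \bar R :=
  ereal_inf [set curve_length c |
             c in [set c | closed_curve c /\ S `<=` trace c]].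

(* A partition into k sets is encoded as a k-indexed family of pairwise
   disjoint non-empty sets covering the trace; -oo is the unit of maxe. For
   k > 0 and 0 < curve_length c < +oo the infimum is a minimum. *)
Definition gamma (R : realType) (d : nat) (c : R -> 'rV[R]_d) (k : nat) :
    \bar R :=
  ereal_inf [set ((\big[maxe/-oo]_(i < k) tour_length (S i))
                  / curve_length c)%E |
             S in [set S : 'I_k -> set 'rV[R]_d |
                   classical_sets.partition setT S (trace c)]].

(* The ratio defining gamma makes sense only for 0 < curve_length c < +oo. *)
Definition gamma_sup (R : realType) (d k : nat) : \bar R :=
  ereal_sup [set gamma c k |
             c in [set c : R -> 'rV[R]_d |
                   closed_curve c /\ (0 < curve_length c < +oo)%E]].

(* Main.v *)
Require Import Defs.
From mathcomp Require Import all_boot all_order all_algebra.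
From mathcomp Require Import all_classical all_reals all_analysis.
From mathcomp Require Import ring lra.
Import Order.TTheory GRing.Theory Num.Theory.
Import numFieldNormedType.Exports.

Set Implicit Arguments.
Unset Strict Implicit.
Unset Printing Implicit Defensive.
Local Open Scope classical_set_scope.
Local Open Scope ring_scope.

(** Normalize the curve to length 1 and parametrize it by arc length, giving a
    1-Lipschitz 1-periodic map [g].  An arc of length [a] with chord [c] lies on
    a closed curve of length [a + c] (run through the arc, come back along the
    chord), so [k] consecutive arcs with [a + c <= T] that exhaust the curve
    yield [gamma <= T].  Arcs of length [T / 2] are always admissible.  Taking
    [T = 2 / k] makes all arcs admissible for free; a smaller [T] requires some
    arcs to be longer than [T / 2], hence to have chords visibly shorter than
    themselves.

    Such arcs exist because a closed curve cannot be straight on average.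
    Cut the curve into [3 k] arcs of equal length.  By discrete Fourier analysis
    of the division points, the mean square of the chords spanning three arcs is
    at most the square of the corresponding chord of a regular [3 k]-gon with
    sides [1 / (3 k)] ([sum_sqr_increment3], [sum_sqr_chord3]).  Hence for some
    [t] the chords of the two adjacent arcs [t, t + 1/k] and [t + 1/k, t + 2/k]
    have a sum of squares at most twice that square ([two_short_chords]).

    Then either one of the two chords is short enough for a single arc to make
    up for all of the missing length [1 - k T / 2], or both are short enough for
    the two arcs, extended outwards, to make up for half of it each
    ([gamma_sup_le]).  What remains is numerical: an upper bound for
    [cos (2 pi / (3 k))], which comes from concavity of the sine between
    [pi / (3 k)] and [pi / 6], except that [k = 3] needs a sharper value, read
    off the triple angle formula.

    Two facts of a general nature complete the argument: arc length is
    continuous, which gives the parametrization ([lipschitz_reparametrization]),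
    and the pieces of a cover of the curve can be turned into a partition into
    exactly [k] non-empty sets ([cover_refine_partition]). *)

(** * Fourier analysis of periodic sequences *)

Section DiscreteFourier.
Variable R : realType.
Implicit Types (x y : R) (P : nat -> R) (i j l m n N : nat).

Lemma cosDpi2n x n : cos (x + (pi *+ 2) *+ n) = cos x.
Proof. exact: periodicn (@cosD2pi R) n x. Qed.

Lemma sinDpi2n x n : sin (x + (pi *+ 2) *+ n) = sin x.
Proof. exact: periodicn (@sinD2pi R) n x. Qed.

Lemma cos_lt1 x : 0 < x < pi *+ 2 -> cos x < 1.
Proof.
move=> /andP[x0 x2].
have sx : 0 < sin (x / 2) by apply: sin_gt0_pi; apply/andP; split; lra.
have -> : x = (x / 2) *+ 2 by rewrite -mulr_natr; field.
by rewrite cos_mulr2n cos2sin2; nra.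
Qed.

(** The real part of a vanishing geometric sum of roots of unity: rotating
    all terms by [x] permutes them. *)
Lemma sum_cos_eq0 N x : cos (N%:R * x) = 1 -> sin (N%:R * x) = 0 ->
  cos x != 1 -> \sum_(j < N) cos (j%:R * x) = 0.
Proof.
move=> cN sN cx1.
set C := LHS; pose S := \sum_(j < N) sin (j%:R * x).
have shift (f : nat -> R) : f N = f 0%N ->
    \sum_(j < N) f j.+1 = \sum_(j < N) f j.
  move=> fN; apply: (addrI (f 0%N)).
  by rewrite -(big_ord_recl N (fun j : 'I_N.+1 => f j)) big_ord_recr /= fN addrC.
have EC : C * cos x - S * sin x = C.
  rewrite /C -[RHS](shift (fun j => cos (j%:R * x))) ?cN ?mul0r ?cos0//.
  rewrite mulr_suml mulr_suml -sumrB; apply: eq_bigr => j _.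
  by rewrite -natr1 mulrDl mul1r cosD.
have ES : S * cos x + C * sin x = S.
  rewrite /S -[RHS](shift (fun j => sin (j%:R * x))) ?sN ?mul0r ?sin0//.
  rewrite mulr_suml mulr_suml -big_split; apply: eq_bigr => j _.
  by rewrite -natr1 mulrDl mul1r sinD.
have E : (1 - cos x) * C = 0.
  have := cos2Dsin2 x; nra.
by move/eqP: E; rewrite mulf_eq0 subr_eq0 eq_sym (negPf cx1) => /eqP.
Qed.

Definition angle N n : R := n%:R * (pi *+ 2 / N%:R).

Lemma natrM_angle N n : (0 < N)%N -> N%:R * angle N n = (pi *+ 2) *+ n.
Proof.
move=> N0; have Nn : N%:R != 0 :> R by rewrite pnatr_eq0 -lt0n.
by rewrite /angle -[RHS]mulr_natr; field.
Qed.

Lemma cos_orthogonality N m n : (0 < N)%N -> (n < N)%N ->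
  \sum_(j < N) cos (j%:R * (angle N m - angle N n)) = N%:R *+ (m %% N == n)%N.
Proof.
move=> N0 nN.
have Nn : N%:R != 0 :> R by rewrite pnatr_eq0 -lt0n.
have Np : 0 < N%:R :> R by rewrite ltr0n.
have red j : cos (j%:R * (angle N m - angle N n)) =
    cos (j%:R * (angle N (m %% N) - angle N n)).
  rewrite -[RHS](cosDpi2n _ (j * (m %/ N))); congr cos.
  rewrite {1}(divn_eq m N) /angle natrD natrM -[_ *+ (j * _)]mulr_natr natrM.
  by field.
under eq_bigr do rewrite red.
have mN : (m %% N < N)%N by rewrite ltn_mod.
move: (m %% N)%N mN => {red}m mN.
case: eqVneq => [->|mn].
  under eq_bigr do rewrite subrr mulr0 cos0.
  by rewrite sumr_const card_ord.
have ex : N%:R * (angle N m - angle N n) = (pi *+ 2) *+ m - (pi *+ 2) *+ n.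
  by rewrite mulrBr !natrM_angle.
have c2 k : cos ((pi *+ 2) *+ k) = 1 :> R by rewrite -[_ *+ k]add0r cosDpi2n cos0.
have s2 k : sin ((pi *+ 2) *+ k) = 0 :> R by rewrite -[_ *+ k]add0r sinDpi2n sin0.
apply: sum_cos_eq0.
- by rewrite ex cosB !c2 !s2 mulr0 addr0 mulr1.
- by rewrite ex sinB !c2 !s2 mulr0 mul0r subr0.
have [p0 P0] : 0 < pi *+ 2 / N%:R :> R /\ N%:R * (pi *+ 2 / N%:R) = pi *+ 2 :> R.
  split; last by field.
  by rewrite divr_gt0// mulrn_wgt0// pi_gt0.
have gap a b : (a < b)%N -> (b < N)%N -> cos (angle N b - angle N a) < 1.
  move=> ab bN; apply: cos_lt1.
  rewrite /angle -mulrBl -natrB 1?ltnW// mulr_gt0 ?ltr0n ?subn_gt0//=.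
  rewrite -[ltRHS]P0 ltr_pM2r// ltr_nat.
  by rewrite (leq_ltn_trans _ bN)// leq_subr.
case: ltngtP mn => // [mn|nm] _; last by rewrite lt_eqF// gap.
by rewrite -cosN opprB lt_eqF// gap.
Qed.

Section Correlation.
Variables (N : nat) (P : nat -> R).
Hypotheses (N0 : (0 < N)%N) (perP : forall i, P (i + N)%N = P i).

Lemma periodic_modn i : P (i %% N) = P i.
Proof.
rewrite [in RHS](divn_eq i N) addnC.
by elim: (i %/ N)%N => [|q IH]; rewrite ?mul0n ?addn0// mulSnr addnA perP.
Qed.

Lemma sum_periodic_shift (F : nat -> R) m : (forall i, F (i + N)%N = F i) ->
  \sum_(i < N) F (i + m)%N = \sum_(i < N) F i.
Proof.
move=> FN; elim: m => [|m IH]; first by under eq_bigr do rewrite addn0.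
rewrite -{}IH.
apply: (addrI (F m)).
under eq_bigr do rewrite addnS -addSn.
rewrite -(big_ord_recl N (fun i : 'I_N.+1 => F (i + m)%N)) big_ord_recr /=.
by rewrite [(N + m)%N]addnC FN addrC.
Qed.

(** Squared modulus of the [j]-th discrete Fourier coefficient. *)
Definition power_spectrum j : R :=
  (\sum_(i < N) P i * cos (j%:R * angle N i)) ^+ 2 +
  (\sum_(i < N) P i * sin (j%:R * angle N i)) ^+ 2.

Lemma power_spectrum_ge0 j : 0 <= power_spectrum j.
Proof. by rewrite addr_ge0 ?sqr_ge0. Qed.

(** Wiener-Khinchin: the power spectrum is the cosine transform of the
    autocorrelation. *)
Lemma autocorrelationE m :
  N%:R * \sum_(i < N) P i * P (i + m)%N =
  \sum_(j < N) power_spectrum j * cos (j%:R * angle N m).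
Proof.
transitivity (\sum_(j < N) \sum_(i < N) \sum_(l < N)
    P i * P l * cos (j%:R * (angle N (i + m) - angle N l))); last first.
  apply: eq_bigr => j _; rewrite /power_spectrum.
  set Y := _ * angle N m.
  pose f i := P i * cos (j%:R * angle N i); pose g i := P i * sin (j%:R * angle N i).
  rewrite -/(f) -/(g).
  transitivity (\sum_(i < N) ((f i * cos Y - g i * sin Y) * \sum_(l < N) f l +
                   (g i * cos Y + f i * sin Y) * \sum_(l < N) g l)).
    apply: eq_bigr => i _; rewrite !mulr_sumr -big_split; apply: eq_bigr => l _.
    have -> : j%:R * (angle N (i + m) - angle N l) =
        j%:R * angle N i + Y - j%:R * angle N l by rewrite /Y /angle natrD; ring.
    by rewrite /= /f /g cosB cosD sinD; ring.
  rewrite big_split /= -!mulr_suml sumrB big_split /= -!mulr_suml; ring.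
rewrite exchange_big /= mulr_sumr; apply: eq_bigr => i _.
rewrite exchange_big /=.
pose l0 := Ordinal (ltn_pmod (i + m) N0).
rewrite (bigD1 l0)//= -mulr_sumr cos_orthogonality ?ltn_pmod// eqxx mulr1n.
rewrite periodic_modn big1 ?addr0; first by ring.
move=> l ll0; rewrite -mulr_sumr cos_orthogonality//.
rewrite (_ : _ == _ = false) ?mulr0n ?mulr0//.
by apply/negbTE; apply: contra ll0 => /eqP E; apply/eqP/val_inj; rewrite /= E.
Qed.

Lemma sum_sqr_increment m :
  N%:R * \sum_(i < N) (P (i + m)%N - P i) ^+ 2 =
  2 * \sum_(j < N) power_spectrum j * (1 - cos (j%:R * angle N m)).
Proof.
have E : \sum_(i < N) (P (i + m)%N - P i) ^+ 2 =
    2 * (\sum_(i < N) P i * P (i + 0)%N - \sum_(i < N) P i * P (i + m)%N).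
  have S : \sum_(i < N) P (i + m)%N ^+ 2 = \sum_(i < N) P i ^+ 2.
    by apply: (sum_periodic_shift (F := fun i => P i ^+ 2)) => i; rewrite perP.
  transitivity (\sum_(i < N) P (i + m)%N ^+ 2 + \sum_(i < N) P i ^+ 2 -
      2 * \sum_(i < N) P i * P (i + m)%N).
    rewrite mulr_sumr -big_split -sumrB; apply: eq_bigr => i _ /=; ring.
  rewrite S; under [\sum_(i < N) P i * P (i + 0)%N]eq_bigr do rewrite addn0.
  by under [in RHS]eq_bigr do rewrite -expr2; ring.
rewrite E mulrCA mulrBr !autocorrelationE -sumrB; congr (_ * _).
apply: eq_bigr => j _; rewrite {1}/angle !mul0r mulr0 cos0; ring.
Qed.

Lemma cos_angle_le j : (0 < j < N)%N -> cos (angle N j) <= cos (angle N 1).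
Proof.
move=> /andP[j0 jN].
have Np : 0 < N%:R :> R by rewrite ltr0n.
have PN : N%:R * (pi *+ 2 / N%:R) = pi *+ 2 :> R by field; rewrite gt_eqF.
have p0 : 0 < pi *+ 2 / N%:R :> R by rewrite divr_gt0// mulrn_wgt0// pi_gt0.
have sym k : (k < N)%N -> cos (angle N (N - k)) = cos (angle N k).
  move=> kN; rewrite /angle natrB 1?ltnW// mulrBl PN addrC.
  by rewrite -[X in _ + X]mulr1n cosDpi2n cosN.
have half k : (0 < k)%N -> (k.*2 <= N)%N -> cos (angle N k) <= cos (angle N 1).
  move=> k0 kN.
  have kpi : angle N k <= pi.
    have : k.*2%:R <= N%:R :> R by rewrite ler_nat.
    by rewrite /angle -muln2 natrM; move: PN; nra.
  have k1 : angle N 1 <= angle N k by rewrite ler_pM2r// ler_nat.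
  have a1 : 0 <= angle N 1 by rewrite mulr_ge0// ltW.
  rewrite leNgt ltr_cos ?in_itv/= -?leNgt//.
    by rewrite kpi (le_trans a1).
  by rewrite a1 (le_trans k1).
have [jj|jj] := leqP j.*2 N; first exact: half.
rewrite -sym//; apply: half; first by rewrite subn_gt0.
by rewrite doubleB leq_subLR -addnn leq_add2r ltnW.
Qed.

(** Frequency by frequency, [1 - cos (3 x) = (1 - cos x) (1 + 2 cos x) ^+ 2],
    and the last factor is largest at the lowest non-zero frequency.  Equality
    holds for the regular polygon. *)
Lemma sum_sqr_increment3 : 0 <= cos (angle N 1) ->
  \sum_(i < N) (P (i + 3)%N - P i) ^+ 2 <=
  (1 + 2 * cos (angle N 1)) ^+ 2 * \sum_(i < N) (P (i + 1)%N - P i) ^+ 2.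
Proof.
move=> c0; have Np : 0 < N%:R :> R by rewrite ltr0n.
rewrite -(ler_pM2l Np) mulrCA !sum_sqr_increment mulrCA ler_pM2l//.
rewrite mulr_sumr; apply: ler_sum => j _.
rewrite [leRHS]mulrCA ler_wpM2l ?power_spectrum_ge0//.
have -> : j%:R * angle N 1 = angle N j by rewrite /angle mul1r.
have -> : j%:R * angle N 3 = angle N j *+ 2 + angle N j.
  by rewrite /angle; ring.
set x := angle N j.
have -> : 1 - cos (x *+ 2 + x) = (1 - cos x) * (1 + 2 * cos x) ^+ 2.
  rewrite cosD cos_mulr2n sin_mulr2n.
  have -> : (cos x * sin x) *+ 2 * sin x = 2 * cos x * (1 - cos x ^+ 2).
    by rewrite -sin2cos2; ring.
  ring.
have [j0|j0] := posnP j.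
  by rewrite /x j0 /angle mul0r cos0 subrr mul0r mulr0.
have xle : cos x <= cos (angle N 1) by apply: cos_angle_le; rewrite j0 ltn_ord.
have x1 := cos_geN1 x.
rewrite [leRHS]mulrC ler_wpM2l ?subr_ge0 ?cos_le1//; nra.
Qed.

End Correlation.
End DiscreteFourier.

(** * Bounds on sines and cosines *)

Section Trigonometry.
Variable R : realType.
Implicit Types (x y : R) (k n N : nat).

(** Concavity of the sine, in the form that [sin x / x] decreases. *)
Lemma sin_concave x y : 0 < x <= y -> y <= pi / 2 -> x * sin y <= y * sin x.
Proof.
move=> /andP[x0 xy] yp.
have ctn a b : {within `[a, b], continuous (@sin R)}.
  by apply: continuous_subspaceT; exact: continuous_sin.
have dsin (z : R) : is_derive z (1 : R) (@sin R) (cos z) by exact: is_derive_sin.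
have [u u0x] := MVT x0 (fun z _ => dsin z) (ctn 0 x).
have [v vxy] := MVT_segment xy (fun z _ => dsin z) (ctn x y).
move: u0x vxy; rewrite !in_itv/= => /andP[u0 ux] /andP[xv vy] Ev Eu.
have cvu : cos v <= cos u.
  rewrite leNgt ltr_cos ?in_itv/= -?leNgt; first by lra.
    by apply/andP; split; lra.
  by apply/andP; split; lra.
move: Eu Ev; rewrite sin0 !subr0 => Eu /eqP; rewrite subr_eq => /eqP ->.
have : 0 <= x * (y - x) * (cos u - cos v).
  by rewrite !mulr_ge0 ?subr_ge0// ltW.
by rewrite Eu; lra.
Qed.

(** [s = sin (pi / 6)] satisfies [3 s - 4 s ^+ 3 = sin (pi / 2) = 1], that is
    [(2 s - 1) ^+ 2 * (s + 1) = 0]. *)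
Lemma sin_pi6 : sin (pi / 6) = 2^-1 :> R.
Proof.
set s := sin _.
have p0 := pi_gt0 R.
have s0 : 0 < s by apply: sin_gt0_pi; apply/andP; split; lra.
have : sin (pi / 2) = 1 :> R by exact: sin_pihalf.
have -> : pi / 2 = (pi / 6) *+ 2 + pi / 6 :> R by rewrite -mulr_natr; field.
rewrite sinD sin_mulr2n cos_mulr2n -/s.
have -> : (cos (pi / 6) * s) *+ 2 * cos (pi / 6) = cos (pi / 6) ^+ 2 * s *+ 2.
  by ring.
rewrite cos2sin2 -/s => h.
have : (2 * s - 1) ^+ 2 * (s + 1) = 0.
  by transitivity (1 - ((1 - s ^+ 2) * s *+ 2 + ((1 - s ^+ 2) *+ 2 - 1) * s));
    [ring | rewrite h subrr].
by move/eqP; rewrite mulf_eq0 sqrf_eq0 => /orP[] /eqP; lra.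
Qed.

Lemma cos_angle1_ge0 N : (4 <= N)%N -> 0 <= cos (angle R N 1).
Proof.
move=> N4; have N4R : 4 <= N%:R :> R by rewrite ler_nat.
have p0 := pi_gt0 R.
have Nn : N%:R != 0 :> R by rewrite gt_eqF//; lra.
apply: cos_ge0_pihalf; rewrite /angle mul1r.
have -> : pi *+ 2 / N%:R = (4 / N%:R) * (pi / 2) :> R by field.
have f1 : 4 / N%:R <= 1 :> R by rewrite ler_pdivrMr; lra.
have f0 : 0 <= 4 / N%:R :> R by rewrite divr_ge0.
by apply/andP; split; nra.
Qed.

(** [1 - cos (2 x) = 2 sin x ^+ 2] with [x = pi / N], and concavity compares
    [sin x] with [sin (pi / 6) = 1/2]; equality for [N = 6]. *)
Lemma cos_angle1_le N : (6 <= N)%N ->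
  cos (angle R N 1) <= 1 - 18 / N%:R ^+ 2.
Proof.
move=> N6; have N6R : 6 <= N%:R :> R by rewrite ler_nat.
have p0 := pi_gt0 R.
have Nn : N%:R != 0 :> R by rewrite gt_eqF//; lra.
have -> : angle R N 1 = (pi / N%:R) *+ 2 by rewrite /angle; ring.
rewrite cos_mulr2n cos2sin2.
have s3 : 3 / N%:R <= sin (pi / N%:R) :> R.
  have h : pi / N%:R * sin (pi / 6) <= pi / 6 * sin (pi / N%:R) :> R.
    apply: sin_concave; last by lra.
    by rewrite divr_gt0 ?(lt_le_trans _ N6R)//= ler_pM2l// lef_pV2 ?posrE//; lra.
  move: h; rewrite sin_pi6.
  have -> : pi / N%:R * 2^-1 = pi / 6 * (3 / N%:R) :> R by field.
  by rewrite ler_pM2l//; lra.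
have -> : 18 / N%:R ^+ 2 = 2 * (3 / N%:R) ^+ 2 :> R by field.
have : 0 <= 3 / N%:R :> R by rewrite divr_ge0.
by move: s3; set a := 3 / _; set s := sin _; nra.
Qed.

(** [z = cos (2 pi / 9)] satisfies [4 z ^+ 3 - 3 z = cos (2 pi / 3) = - 1/2]. *)
Lemma cos_angle9_le : cos (angle R 9 1) <= 77 / 100.
Proof.
have triple x : cos (x *+ 2 + x) = 4 * cos x ^+ 3 - 3 * cos x.
  rewrite cosD cos_mulr2n sin_mulr2n.
  have -> : (cos x * sin x) *+ 2 * sin x = 2 * cos x * sin x ^+ 2 by ring.
  by rewrite sin2cos2; ring.
have p0 := pi_gt0 R.
pose y : R := pi *+ 2 / 3.
have cy : cos y = - 2^-1.
  have y1 : cos y < 1.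
    by apply: cos_lt1; rewrite /y; apply/andP; split; lra.
  have := triple y.
  have -> : y *+ 2 + y = pi *+ 2 by rewrite /y; field.
  rewrite cos2pi => h.
  have : (cos y - 1) * (2 * cos y + 1) ^+ 2 = 0.
    by transitivity (4 * cos y ^+ 3 - 3 * cos y - 1); [ring | rewrite -h subrr].
  by move/eqP; rewrite mulf_eq0 sqrf_eq0 => /orP[] /eqP; lra.
have := triple (angle R 9 1).
have -> : angle R 9 1 *+ 2 + angle R 9 1 = y by rewrite /angle /y; field.
have := @cos_angle1_ge0 9 isT.
rewrite cy; set z := cos _ => z0 h.
rewrite leNgt; apply/negP => zl.
(* The cubic increases on [1/2, 1]: compare its values at [z] and [a]. *)
pose a : R := 77 / 100.
have ha : 4 * a ^+ 3 - 3 * a > - 2^-1 by rewrite /a; lra.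
have : 0 <= (z - a) * (4 * (z ^+ 2 + z * a + a ^+ 2) - 3).
  by rewrite mulr_ge0//; move: zl; rewrite /a; nra.
have -> : (z - a) * (4 * (z ^+ 2 + z * a + a ^+ 2) - 3) =
  (4 * z ^+ 3 - 3 * z) - (4 * a ^+ 3 - 3 * a) by ring.
by lra.
Qed.

End Trigonometry.

(** * Euclidean norm of row vectors *)

Section EuclideanDistance.
Variables (R : realType) (d : nat).
Implicit Types (x y z v w : 'rV[R]_d).

Definition enorm v : R := Num.sqrt (\sum_(i < d) v ord0 i ^+ 2).

Lemma eucl_distE x y : eucl_dist x y = enorm (x - y).
Proof. by congr Num.sqrt; apply: eq_bigr => i _; rewrite !mxE. Qed.

Lemma enorm_ge0 v : 0 <= enorm v. Proof. exact: sqrtr_ge0. Qed.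

Lemma sqr_enorm v : enorm v ^+ 2 = \sum_(i < d) v ord0 i ^+ 2.
Proof. by rewrite sqr_sqrtr// sumr_ge0// => i _; rewrite sqr_ge0. Qed.

Lemma enormZ (a : R) v : enorm (a *: v) = `|a| * enorm v.
Proof.
rewrite -sqrtr_sqr -sqrtrM ?sqr_ge0//; congr Num.sqrt.
by rewrite mulr_sumr; apply: eq_bigr => i _; rewrite mxE exprMn.
Qed.

Lemma enormN v : enorm (- v) = enorm v.
Proof. by rewrite -scaleN1r enormZ normrN1 mul1r. Qed.

Lemma enorm0 : enorm 0 = 0.
Proof. by rewrite -[0 in LHS](scale0r 0) enormZ normr0 mul0r. Qed.

Lemma cauchy_schwarz (a b : 'I_d -> R) :
  (\sum_i a i * b i) ^+ 2 <= (\sum_i a i ^+ 2) * (\sum_i b i ^+ 2).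
Proof.
set A := \sum_i a i ^+ 2; set B := \sum_i b i ^+ 2; set C := \sum_i _.
have E : \sum_i (B * a i - C * b i) ^+ 2 = B * (A * B - C ^+ 2).
  transitivity (B ^+ 2 * A - 2 * B * C * C + C ^+ 2 * B); last by ring.
  have -> : B ^+ 2 * A = \sum_i B ^+ 2 * a i ^+ 2 by rewrite /A mulr_sumr.
  have -> : 2 * B * C * C = \sum_i 2 * B * C * (a i * b i).
    by rewrite {2}/C mulr_sumr.
  have -> : C ^+ 2 * B = \sum_i C ^+ 2 * b i ^+ 2 by rewrite /B mulr_sumr.
  rewrite -sumrB -big_split; apply: eq_bigr => i _ /=; ring.
have B0 : 0 <= B by apply: sumr_ge0 => i _; rewrite sqr_ge0.
have : 0 <= B * (A * B - C ^+ 2).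
  by rewrite -E; apply: sumr_ge0 => i _; rewrite sqr_ge0.
move: B0; rewrite le_eqVlt => /predU1P[B0|B0]; last by rewrite pmulr_rge0// subr_ge0.
move=> _; rewrite -B0 mulr0.
suff -> : C = 0 by rewrite expr0n.
apply: big1 => i _; apply/eqP; rewrite mulf_eq0 orbC -sqrf_eq0.
move/esym/eqP: B0; rewrite psumr_eq0 => [/allP/(_ i)|j _]; last exact: sqr_ge0.
by rewrite mem_index_enum => /(_ isT) /= ->.
Qed.

Lemma enormD v w : enorm (v + w) <= enorm v + enorm w.
Proof.
rewrite -(@ler_pXn2r _ 2)// ?nnegrE ?addr_ge0 ?enorm_ge0//.
have := cauchy_schwarz (fun i => v ord0 i) (fun i => w ord0 i).
rewrite -!sqr_enorm; set C := \sum_i _ => h.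
have -> : enorm (v + w) ^+ 2 = enorm v ^+ 2 + 2 * C + enorm w ^+ 2.
  rewrite !sqr_enorm mulr_sumr -!big_split; apply: eq_bigr => i _ /=.
  by rewrite mxE; ring.
have : C <= enorm v * enorm w.
  rewrite (le_trans (ler_norm _))// -(@ler_pXn2r _ 2)//.
    by rewrite real_normK ?num_real// exprMn.
  by rewrite nnegrE mulr_ge0 ?enorm_ge0.
by lra.
Qed.

Lemma eucl_dist_ge0 x y : 0 <= eucl_dist x y.
Proof. exact: sqrtr_ge0. Qed.

Lemma eucl_distxx x : eucl_dist x x = 0.
Proof. by rewrite eucl_distE subrr enorm0. Qed.

Lemma eucl_distC x y : eucl_dist x y = eucl_dist y x.
Proof. by rewrite !eucl_distE -enormN opprB. Qed.

Lemma eucl_dist_triangle y x z :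
  eucl_dist x z <= eucl_dist x y + eucl_dist y z.
Proof.
rewrite !eucl_distE; have -> : x - z = (x - y) + (y - z) by rewrite addrA subrK.
exact: enormD.
Qed.

(** Comparison with the sup norm, which carries the topology of row vectors. *)
Lemma norm_le_enorm v : `|v| <= enorm v.
Proof.
rewrite /Num.norm/= mx_normrE; apply/bigmax_leP; split; first exact: enorm_ge0.
move=> [i j] _ /=; rewrite (ord1 i) -sqrtr_sqr ler_wsqrtr//.
by rewrite (bigD1 j)//= lerDl sumr_ge0// => l _; rewrite sqr_ge0.
Qed.

Lemma enorm_le_norm v : enorm v <= d%:R * `|v|.
Proof.
rewrite -(@ler_pXn2r _ 2)// ?nnegrE ?enorm_ge0 ?mulr_ge0//.
rewrite sqr_enorm.
have h i : v ord0 i ^+ 2 <= `|v| ^+ 2.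
  rewrite -(real_normK (num_real (v ord0 i))) ler_pXn2r ?nnegrE//.
  by rewrite [leRHS]/Num.norm/= mx_normrE (le_bigmax _ _ (ord0, i)).
have : \sum_(i < d) v ord0 i ^+ 2 <= \sum_(i < d) `|v| ^+ 2.
  by apply: ler_sum => i _; exact: h.
move=> /le_trans; apply.
rewrite sumr_const card_ord exprMn -[leLHS]mulr_natl ler_wpM2r ?sqr_ge0//.
by rewrite -natrX ler_nat; case: d => // n; rewrite leq_pmulr.
Qed.

Lemma eucl_dist_eq0 x y : eucl_dist x y = 0 -> x = y.
Proof.
rewrite eucl_distE => h; apply/eqP; rewrite -subr_eq0 -normr_le0 -h.
exact: norm_le_enorm.
Qed.

End EuclideanDistance.

(** * Polygonal lengths and closed curves made of an arc and its chord *)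

Section Tours.
Variables (R : realType) (d : nat).
Implicit Types (c : R -> 'rV[R]_d) (a b u v : R) (s : seq R).

(** [polygonal_length] with a free initial point, for inductions on the list. *)
Definition polyline c a s : R :=
  \sum_(0 <= i < size s)
    eucl_dist (c (nth 1 (a :: s) i)) (c (nth 1 (a :: s) i.+1)).

Lemma polyline_nil c a : polyline c a [::] = 0.
Proof. by rewrite /polyline big_nil. Qed.

Lemma polyline_cons c a x s :
  polyline c a (x :: s) = eucl_dist (c a) (c x) + polyline c x s.
Proof. by rewrite /polyline /= big_nat_recl. Qed.

Lemma polyline_cat c a s s' :
  polyline c a (s ++ s') = polyline c a s + polyline c (last a s) s'.
Proof.
elim: s a => [|x s IH] a; first by rewrite polyline_nil add0r.
by rewrite cat_cons !polyline_cons IH addrA.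
Qed.

Lemma polyline_ge0 c a s : 0 <= polyline c a s.
Proof. by apply: sumr_ge0 => i _; exact: eucl_dist_ge0. Qed.

Lemma curve_length_le c (h : R -> R) :
  (forall u v, 0 <= u -> u <= v -> v <= 1 ->
    eucl_dist (c u) (c v) <= h v - h u) ->
  (curve_length c <= (h 1 - h 0)%:E)%E.
Proof.
move=> hc; apply: ge_ereal_sup => _ [s part_s <-]; rewrite lee_fin.
rewrite -[leLHS]/(polyline c 0 s).
suff {part_s} H a : 0 <= a -> itv_partition a 1 s ->
    polyline c a s <= h 1 - h a by exact: H (lexx 0) part_s.
elim: s a => [|x s IH] a a0.
  by move=> /itv_partition_nil ->; rewrite polyline_nil subrr.
move=> part_s; have part_x := itv_partition_cons part_s.
case: part_s => /= /andP[/ltW ax _] _; rewrite polyline_cons.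
have := hc _ _ a0 ax (itv_partition_le part_x).
by have := IH _ (le_trans a0 ax) part_x; lra.
Qed.

Lemma lipschitz_continuous c (K : R) :
  (forall u v, u <= v -> eucl_dist (c u) (c v) <= K * (v - u)) -> continuous c.
Proof.
move=> hc.
have bnd x t : `|c x - c t| <= `|K| * `|x - t|.
  wlog : x t / x <= t => [W|le_xt].
    have [|/ltW] := leP x t; first exact: W.
    by move=> /W; rewrite distrC [in `|t - x|]distrC.
  rewrite (le_trans (norm_le_enorm _))// -eucl_distE (le_trans (hc _ _ le_xt))//.
  by rewrite [`|x - t|]distrC [`|t - x|]ger0_norm ?subr_ge0// ler_wpM2r ?subr_ge0// ler_norm.
move=> x; apply/cvgrPdist_le => e e0.
have K1 : 0 < `|K| + 1 by rewrite ltr_wpDl.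
have ek : 0 < e / (`|K| + 1) by rewrite divr_gt0.
near=> t.
have xt : `|x - t| <= e / (`|K| + 1).
  by near: t; apply: cvgr_dist_le => //; exact: cvg_id.
move: xt; rewrite ler_pdivlMr// => xt.
by rewrite (le_trans (bnd x t))// (le_trans _ xt)// mulrC ler_wpM2l// lerDl.
Unshelve. all: by end_near. Qed.

(** The closed curve that runs through the arc and comes back along its chord
    contains [S]. *)
Lemma tour_length_arc c (L a b : R) (S : set 'rV[R]_d) :
  (forall u v, u <= v -> eucl_dist (c u) (c v) <= L * (v - u)) ->
  a <= b -> S `<=` c @` `[a, b] ->
  (tour_length S <= (L * (b - a) + eucl_dist (c a) (c b))%:E)%E.
Proof.
move=> lip ab Sab; set D := eucl_dist _ _.
have D0 : 0 <= D by exact: eucl_dist_ge0.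
have DL : D <= L * (b - a) by exact: lip.
(* The arc is run through on [0, 1/2] and the chord on [1/2, 1]. *)
pose p u := Num.min (2 * u) 1; pose q u := 2 * u - p u.
have pq u v : u <= v -> p u <= p v /\ q u <= q v.
  move=> uv; rewrite /q /p /Num.min.
  by case: ifPn => hu; case: ifPn => hv; move: hu hv; rewrite -?leNgt; lra.
pose t u := c (a + p u * (b - a)) + q u *: (c a - c b).
have lipt u v : u <= v -> eucl_dist (t u) (t v) <=
    (L * (b - a) * p v + D * q v) - (L * (b - a) * p u + D * q u).
  move=> uv; have [puv quv] := pq _ _ uv.
  rewrite (le_trans (@eucl_dist_triangle _ _
    (c (a + p v * (b - a)) + q u *: (c a - c b)) _ _))//.
  have -> : L * (b - a) * p v + D * q v - (L * (b - a) * p u + D * q u) =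
    L * (a + p v * (b - a) - (a + p u * (b - a))) + (q v - q u) * D by ring.
  apply: lerD.
    have -> : eucl_dist (t u) (c (a + p v * (b - a)) + q u *: (c a - c b)) =
        eucl_dist (c (a + p u * (b - a))) (c (a + p v * (b - a))).
      by rewrite !eucl_distE /t opprD addrACA subrr addr0.
    by apply: lip; rewrite lerD2l ler_wpM2r// subr_ge0.
  rewrite eucl_distC eucl_distE /t opprD addrACA subrr add0r -scalerBl enormZ.
  by rewrite ger0_norm ?subr_ge0// -eucl_distE.
have p0 : p 0 = 0 by rewrite /p mulr0 min_l.
have p1 : p 1 = 1 by rewrite /p min_r//; lra.
have q0 : q 0 = 0 by rewrite /q p0; lra.
have q1 : q 1 = 1 by rewrite /q p1; lra.
have := @curve_length_le t (fun u => L * (b - a) * p u + D * q u)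
  (fun u v _ uv _ => lipt u v uv).
rewrite p0 p1 q0 q1 !mulr0 !mulr1 addr0 subr0; apply: le_trans.
apply: ereal_inf_lbound; exists t => //; split; first split.
- apply: continuous_subspaceT.
  apply: (@lipschitz_continuous t (2 * (L * (b - a) + D))) => u v uv.
  rewrite (le_trans (lipt _ _ uv))//; have [puv quv] := pq _ _ uv.
  have p2 : p v - p u <= 2 * (v - u) by move: quv; rewrite /q; lra.
  have q2 : q v - q u <= 2 * (v - u) by rewrite /q; lra.
  have L0 : 0 <= L * (b - a) by lra.
  have := ler_wpM2l L0 p2; have := ler_wpM2l D0 q2; lra.
- by rewrite /t p0 p1 q0 q1 mul0r mul1r addr0 scale0r addr0 scale1r !subrKC.
- move=> x /Sab[w /=]; rewrite in_itv/= => /andP[aw wb] <-.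
  pose r := (w - a) / (b - a).
  have r0 : 0 <= r by rewrite divr_ge0 ?subr_ge0.
  have r1 : r <= 1.
    rewrite /r; have [->|nab] := eqVneq a b; first by rewrite subrr invr0 mulr0.
    by rewrite ler_pdivrMr ?subr_gt0 ?lt_neqAle ?nab// mul1r lerB.
  have pr : p (r / 2) = r by rewrite /p min_l; lra.
  exists (r / 2); first by rewrite /= in_itv/=; apply/andP; split; lra.
  rewrite /t /q pr (_ : 2 * _ - _ = 0); last by lra.
  rewrite scale0r addr0; congr c; rewrite /r.
  have [ab'|nab] := eqVneq a b; last first.
    by rewrite divfK ?subr_eq0 1?eq_sym// addrC subrK.
  by rewrite ab' subrr mulr0 addr0; apply/eqP; rewrite eq_le wb -ab' aw.
Qed.

End Tours.

(** * Parametrization by arc length *)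

Section ArcLength.
Variables (R : realType) (d : nat) (c : R -> 'rV[R]_d) (L : R).
Hypotheses (cc : closed_curve c) (cL : curve_length c = L%:E).
Implicit Types (a b t u v x y z : R) (q s : seq R).

Local Notation dist := (@eucl_dist R d).

(* Repetitions are allowed in the inscribed polygonal lines. *)
Let refine a b s : path <=%O a s -> last a s <= b ->
  exists s', [/\ path <%O a s', last a s' = b & polyline c a s <= polyline c a s'].
Proof.
elim: s a => [|x s IH] a /=.
  move=> _; rewrite le_eqVlt => /predU1P[->|ab].
    by exists [::]; split.
  by exists [:: b]; rewrite /= ab polyline_nil polyline_ge0.
move=> /andP[ax xs] /(IH _ xs)[s' [xs' ls' le_s']].
move: ax; rewrite le_eqVlt => /predU1P[->|ax].
  by exists s'; split=> //; rewrite polyline_cons eucl_distxx add0r.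
by exists (x :: s'); split=> //=; rewrite ?ax// !polyline_cons lerD2l.
Qed.

Let polyline_le_length s : path <=%O 0 s -> last 0 s <= 1 -> polyline c 0 s <= L.
Proof.
move=> ps /(refine ps)[s' [ps' ls' /le_trans]]; apply.
rewrite -lee_fin -cL; apply: ereal_sup_ubound; exists s' => //.
by split=> //; apply/eqP.
Qed.

(** Increasing lists ending at or before [t], rather than partitions ending at
    [t], make monotonicity in [t] immediate. *)
Definition arc_length t : R :=
  sup [set polyline c 0 s | s in [set s | path <=%O 0 s /\ last 0 s <= t]].
Local Notation ell := arc_length.

Let polyline_le_ell t s : t <= 1 -> path <=%O 0 s -> last 0 s <= t ->
  polyline c 0 s <= ell t.
Proof.
move=> t1 ps ls; apply: ub_le_sup; last by exists s.
exists L => _ [s' [ps' ls'] <-]; apply: polyline_le_length => //.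
exact: le_trans ls' t1.
Qed.

Let ell_le t (M : R) : 0 <= t -> (forall s, path <=%O 0 s -> last 0 s <= t ->
  polyline c 0 s <= M) -> ell t <= M.
Proof.
move=> t0 h; apply: ge_sup; first by exists (polyline c 0 [::]), [::].
by move=> _ [s [ps ls] <-]; exact: h.
Qed.

(** A polygonal line up to [t] can be continued by one from [t] to [u]. *)
Let ell_cat t s u : 0 <= t -> path <=%O t s -> last t s <= u -> u <= 1 ->
  ell t + polyline c t s <= ell u.
Proof.
move=> t0 ts lu u1; rewrite -lerBrDr; apply: ell_le => // q pq lq.
rewrite lerBrDr.
apply: (@le_trans _ _ (polyline c 0 (q ++ t :: s))).
  by rewrite polyline_cat polyline_cons addrA lerD2r lerDl eucl_dist_ge0.
by apply: polyline_le_ell; rewrite ?cat_path ?last_cat //= pq lq.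
Qed.

Let ell_dist t u : 0 <= t -> t <= u -> u <= 1 -> dist (c t) (c u) <= ell u - ell t.
Proof.
move=> t0 tu u1; have := @ell_cat t [:: u] u t0.
by rewrite /= tu polyline_cons polyline_nil addr0 lerBrDl; apply.
Qed.

Let ell0 : ell 0 = 0.
Proof.
have ell0_ge : polyline c 0 [::] <= ell 0 by exact: polyline_le_ell ler01 _ _.
rewrite polyline_nil in ell0_ge.
apply/eqP; rewrite eq_le ell0_ge andbT.
suff : ell 1 <= ell 1 - ell 0 by lra.
apply: ell_le => // s ps ls; rewrite lerBrDl; exact: ell_cat.
Qed.

Let ell1 : ell 1 = L.
Proof.
apply/eqP; rewrite eq_le; apply/andP; split.
  by apply: ell_le => // s; exact: polyline_le_length.
rewrite -lee_fin -cL; apply: ge_ereal_sup => _ [s [ps /eqP ls] <-].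
rewrite lee_fin; apply: polyline_le_ell => //; last by rewrite ls.
by apply: sub_path ps => ? ?; exact: ltW.
Qed.

Let polyline_split a y x s : a <= y -> y <= x -> x <= 1 ->
  path <=%O a s -> last a s <= 1 -> all (fun z => (z <= y) || (x <= z)) s ->
  exists q1 q2,
    [/\ path <=%O a q1, last a q1 <= y, path <=%O x q2, last x q2 <= 1 &
      polyline c a s <= polyline c a (rcons q1 y) + dist (c y) (c x)
        + polyline c x q2].
Proof.
move=> ay yx x1; elim: s a ay => [|z s IH] a ay /=.
  move=> _ _ _; exists [::], [::]; split=> //=.
  by rewrite !polyline_nil !addr_ge0 ?polyline_ge0 ?eucl_dist_ge0.
move=> /andP[az zs] ls /andP[/orP[zy|xz] gs].
  have [q1 [q2 [pq1 lq1 pq2 lq2 h]]] := IH _ zy zs ls gs.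
  exists (z :: q1), q2; split=> //=; first by rewrite az.
  by rewrite !polyline_cons -!addrA lerD2l addrA.
exists [::], (z :: s); split=> //=; first by rewrite xz.
rewrite !polyline_cons polyline_nil addr0 addrA lerD2r.
rewrite (le_trans (eucl_dist_triangle (c y) _ _))// -addrA lerD2l.
exact: eucl_dist_triangle.
Qed.

(* A polygonal line without vertices strictly between [y] and [x] misses, up
   to one chord, all the length between them. *)
Let polyline_gap y x s : 0 <= y -> y <= x -> x <= 1 ->
  path <=%O 0 s -> last 0 s <= 1 -> all (fun z => (z <= y) || (x <= z)) s ->
  polyline c 0 s <= ell y + dist (c y) (c x) + (L - ell x).
Proof.
move=> y0 yx x1 ps ls gs.
have [q1 [q2 [pq1 lq1 pq2 lq2 h]]] := polyline_split y0 yx x1 ps ls gs.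
apply: (le_trans h); rewrite -ell1 lerD ?lerD//.
  apply: polyline_le_ell; rewrite ?last_rcons ?rcons_path ?pq1//.
  exact: le_trans yx x1.
by rewrite lerBrDl; apply: ell_cat => //; exact: le_trans y0 yx.
Qed.

Let curve_near x (e : R) : 0 <= x <= 1 -> 0 < e ->
  exists2 del : R, 0 < del & forall t, 0 <= t <= 1 -> `|x - t| < del ->
    dist (c x) (c t) <= e.
Proof.
move=> x01 e0; have [cont _] := cc.
have d1 : 0 < d%:R + 1 :> R by rewrite ltr_wpDl.
have ed : 0 < e / (d%:R + 1) by rewrite divr_gt0.
have xI : `[0, 1]%classic x by rewrite /= in_itv.
have /subspace_continuousP/(_ x xI) := cont.
move=> /cvgrPdist_le/(_ _ ed); rewrite near_withinE => /nbhs_ballP[del /= del0 h].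
exists del => // t t01 xt; have := h t xt; rewrite /= in_itv/= => /(_ t01).
rewrite eucl_distE ler_pdivlMr// => h'.
rewrite (le_trans (enorm_le_norm _))// (le_trans _ h')// mulrC ler_wpM2l//.
by rewrite lerDl ler01.
Qed.

Let isolate x s : exists2 del : R, 0 < del &
  forall z, z \in s -> z != x -> del <= `|x - z|.
Proof.
elim: s => [|z s [del del0 IH]]; first by exists 1.
have [->|zx] := eqVneq z x.
  by exists del => // w; rewrite inE => /predU1P[->|/IH//]; rewrite eqxx.
exists (Num.min del `|x - z|).
  by rewrite lt_min del0 normr_gt0 subr_eq0 eq_sym.
move=> w; rewrite inE ge_min => /predU1P[->|/IH h /h ->//].
by rewrite lexx orbT.
Qed.

(* Fix a polygonal line whose length is within [e / 2] of [L].  Its vertices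
   other than [x] stay away from [x], so nothing of it lies strictly between [x]
   and a nearby [t]; by [polyline_gap] the length between [x] and [t] is at most
   [e / 2] plus the chord. *)
Let ell_near x (e : R) : 0 <= x <= 1 -> 0 < e ->
  exists2 del : R, 0 < del & forall t, 0 <= t <= 1 -> `|x - t| < del ->
    `|ell x - ell t| <= e.
Proof.
move=> x01 e0; have e2 : 0 < e / 2 by rewrite divr_gt0.
have [s [ps ls hs]] : exists s,
    [/\ path <=%O 0 s, last 0 s <= 1 & L - e / 2 < polyline c 0 s].
  apply: contrapT => no; suff : L <= L - e / 2 by lra.
  rewrite -{1}ell1; apply: ell_le => // s ps ls; rewrite leNgt.
  by apply/negP => h; apply: no; exists s.
have [del1 del10 h1] := curve_near x01 e2.
have [del2 del20 h2] := isolate x s.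
exists (Num.min del1 del2); first by rewrite lt_min del10.
move=> t t01; rewrite lt_min => /andP[xt1 xt2].
have main y z : 0 <= y -> y <= z -> z <= 1 -> dist (c y) (c z) <= e / 2 ->
    (forall w, w \in s -> (w <= y) || (z <= w)) -> `|ell z - ell y| <= e.
  move=> y0 yz z1 yze gap.
  have yz_ell := le_trans (eucl_dist_ge0 _ _) (ell_dist y0 yz z1).
  have := polyline_gap y0 yz z1 ps ls (introT allP gap).
  by rewrite ger0_norm//; lra.
move: x01 t01 => /andP[x0 x1] /andP[t0 t1].
have dxt : dist (c x) (c t) <= e / 2 by apply: h1 => //; rewrite t0.
have [xt|/ltW tx] := leP x t; [rewrite distrC|]; apply: main => //.
- move=> w ws; have [->|/(h2 _ ws) wx] := eqVneq w x; first by rewrite lexx.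
  have := lt_le_trans xt2 wx; rewrite [`|x - t|]distrC ger0_norm ?subr_ge0//.
  by have [//|xw] := leP w x; rewrite ltr0_norm ?subr_lt0//=; lra.
- by rewrite eucl_distC.
- move=> w ws; have [->|/(h2 _ ws) wx] := eqVneq w x; first by rewrite lexx orbT.
  have := lt_le_trans xt2 wx; rewrite [`|x - t|]ger0_norm ?subr_ge0//.
  have [_|wx'] := leP x w; first by rewrite orbT.
  by rewrite orbF gtr0_norm ?subr_gt0//=; lra.
Qed.

Let ell_surj v : 0 <= v <= L -> exists2 t : R, 0 <= t <= 1 & ell t = v.
Proof.
move=> vL; have cont : {within `[0, 1], continuous ell}.
  apply/subspace_continuousP => x; rewrite /= in_itv/= => x01.
  apply/cvgrPdist_le => e e0; rewrite near_withinE; apply/nbhs_ballP.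
  have [del del0 h] := ell_near x01 e0.
  by exists del => //= t xt; rewrite in_itv/= => t01; exact: h.
have := @IVT R ell 0 1 v ler01 cont; rewrite ell0 ell1.
have L0 : 0 <= L by case/andP: vL; exact: le_trans.
rewrite min_l// max_r// => /(_ vL)[t]; rewrite in_itv/= => t01 <-.
by exists t.
Qed.

(** Parametrization by arc length: the arc length is continuous, hence takes
    every value, and two parameters with the same arc length have the same
    image. *)
Lemma lipschitz_reparametrization : exists g : R -> 'rV[R]_d,
  [/\ forall u v, u <= v -> dist (g u) (g v) <= L * (v - u),
      forall u, g (u + 1) = g u & g @` `[0, 1] = trace c].
Proof.
have L0 : 0 <= L.
  by rewrite -ell1 -(polyline_nil c 0); exact: polyline_le_ell.
have /choice[sg sgP] : forall u, exists t, 0 <= u <= 1 ->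
    0 <= t <= 1 /\ ell t = L * u.
  move=> u; have [u01|/negP u01] := boolP (0 <= u <= 1); last by exists 0.
  have [|t t01 Et] := @ell_surj (L * u); last by exists t.
  by move: u01 => /andP[u0 u1]; rewrite mulr_ge0//= ler_piMr.
have ell_lip (s t : R) : 0 <= s <= 1 -> 0 <= t <= 1 ->
    dist (c s) (c t) <= `|ell t - ell s|.
  wlog st : s t / s <= t => [W|].
    have [st|/ltW ts] := leP s t; first exact: W.
    by rewrite eucl_distC distrC => ? ?; exact: W.
  by move=> /andP[s0 _] /andP[_ t1]; rewrite (le_trans (ell_dist s0 st t1))// ler_norm.
pose fr (u : R) := u - (Num.floor u)%:~R.
have fr01 u : 0 <= fr u < 1.
  have := floor_itv u; rewrite /fr intrD1 => /andP[? ?]; apply/andP; split; lra.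
have fr01' u : 0 <= fr u <= 1 by have /andP[-> /ltW ->] := fr01 u.
have [_ c01] := cc.
exists (fun u => c (sg (fr u))); split.
- move=> u v uv.
  have [su Eu] := sgP _ (fr01' u); have [sv Ev] := sgP _ (fr01' v).
  have := le_floor uv; rewrite le_eqVlt => /predU1P[Ef|].
    rewrite (le_trans (ell_lip _ _ su sv))// Eu Ev -mulrBr.
    rewrite (_ : fr v - fr u = v - u); last by rewrite /fr Ef; lra.
    by rewrite ger0_norm// mulr_ge0// subr_ge0.
  (* The arc passes through the base point [c 0 = c 1]. *)
  rewrite -lezD1 -(ler_int R) intrD1 => Ef.
  rewrite (le_trans (eucl_dist_triangle (c 1) _ _))//.
  have h1 : dist (c (sg (fr u))) (c 1) <= L * (1 - fr u).
    case/andP: su => su0 su1.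
    by rewrite (le_trans (ell_dist su0 su1 (lexx _)))// ell1 Eu; lra.
  have h2 : dist (c 1) (c (sg (fr v))) <= L * fr v.
    case/andP: sv => sv0 sv1; rewrite -c01.
    by rewrite (le_trans (ell_dist (lexx _) sv0 sv1))// ell0 Ev; lra.
  have : 0 <= L * ((v - u) - (1 - fr u + fr v)).
    by rewrite mulr_ge0// /fr; lra.
  by lra.
- move=> u; congr (c (sg _)); rewrite /fr floorDrz ?rpred1// floor1 intrD1; lra.
- apply/seteqP; split.
    move=> _ [u _ <-]; have [s01 _] := sgP _ (fr01' u).
    by exists (sg (fr u)) => //=; rewrite in_itv.
  move=> _ [t /= t01 <-]; move: t01; rewrite in_itv/= => t01.
  have [t0 t1] := andP t01.
  have ell_t : 0 <= ell t <= L.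
    have := ell_dist (lexx 0) t0 t1; have := ell_dist t0 t1 (lexx 1).
    rewrite ell0 ell1; have := eucl_dist_ge0 (c 0) (c t).
    by have := eucl_dist_ge0 (c t) (c 1); move=> ? ? ? ?; apply/andP; split; lra.
  have same (s : R) : 0 <= s <= 1 -> ell s = ell t -> c s = c t.
    move=> s01 Es; apply: eucl_dist_eq0; apply/eqP; rewrite eq_le eucl_dist_ge0.
    by rewrite andbT (le_trans (ell_lip _ _ s01 t01))// Es subrr normr0.
  have [LE|LE] := eqVneq (ell t) L.
    exists 0 => /=; first by rewrite in_itv/= lexx ler01.
    have [s01 Es] := sgP _ (fr01' 0).
    transitivity (c 1); last by apply: same; rewrite ?ler01 ?lexx// ell1.
    rewrite -c01; apply: eucl_dist_eq0; apply/eqP; rewrite eq_le eucl_dist_ge0.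
    rewrite andbT (le_trans (ell_lip _ _ s01 _)) ?lexx ?ler01//.
    by rewrite ell0 Es /fr floor0 subrr mulr0 subrr normr0.
  have Lp : 0 < L.
    by case/andP: ell_t => h0 hL; rewrite (le_lt_trans h0)// lt_neqAle LE.
  exists (ell t / L) => /=.
    rewrite in_itv/= ler_pdivlMr// ler_pdivrMr// mul0r mul1r.
    exact: ell_t.
  have fE : fr (ell t / L) = ell t / L.
    rewrite /fr (_ : Num.floor _ = 0) ?subr0//; apply: floor_def.
    rewrite add0r ler_pdivlMr// ltr_pdivrMr// mul0r mul1r.
    by case/andP: ell_t => -> hL; rewrite lt_neqAle LE.
  have [s01 Es] := sgP _ (fr01' (ell t / L)).
  by apply: same => //; rewrite Es fE mulrC divfK// gt_eqF.
Qed.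

End ArcLength.

(** * From consecutive arcs to a partition of the curve *)

Section Coverings.

(** Each point is assigned to one member of the cover that contains it; the
    classes left empty are refilled by single points of an infinite class. *)
Lemma cover_refine_partition (T : choiceType) (k : nat) (U : 'I_k -> set T)
    (A : set T) : infinite_set A -> A `<=` \bigcup_i U i ->
  exists S : 'I_k -> set T, classical_sets.partition setT S A /\
    forall i, exists j, S i `<=` U j.
Proof.
move=> Ainf AU.
have /infinite_setN0[a Aa] := Ainf.
have [i0 _ _] := AU _ Aa.
pose f x := xget i0 [set i | U i x].
have fU x : A x -> U (f x) x.
  by move=> /AU[i _ Uix]; apply: (@xgetPex _ i0 [set i | U i x]); exists i.
pose F i := [set x | A x /\ f x = i].
have [j Fj] : exists j, infinite_set (F j).
  apply: contrapT => no; apply: Ainf.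
  apply: (@sub_finite_set _ _ (\bigcup_(i in setT) F i)).
    by move=> x Ax; exists (f x).
  apply: bigcup_finite => [|i _]; first exact: finite_finset.
  apply: contrapT => Fi; apply: no; by exists i.
have [B BF kB] := infinite_set_fset k Fj.
pose y (i : 'I_k) := nth a (finmap.enum_fset B) i.
have ilt (i : 'I_k) : (i < size (finmap.enum_fset B))%N := leq_trans (ltn_ord i) kB.
have yF i : F j (y i) by apply: BF; rewrite /= mem_nth.
have y_inj i i' : y i = y i' -> i = i'.
  by move=> /eqP; rewrite nth_uniq ?finmap.fset_uniq ?ilt// => /eqP/val_inj.
pose g x := if [pick i | `[< x = y i /\ F i = set0 >]] is Some i then i else f x.
have gy i : F i = set0 -> g (y i) = i.
  move=> Fi; rewrite /g; case: pickP => [i' /asboolP[/y_inj-> //]|/(_ i)].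
  by move=> /asboolP[]; split.
have gf x : A x -> F (g x) !=set0 -> g x = f x.
  rewrite /g; case: pickP => // i /asboolP[-> Fi0] _.
  by rewrite Fi0 => -[? []].
exists (fun i => [set x | A x /\ g x = i]); split; first split.
- by apply/seteqP; split=> [x [i _ [] //]|x Ax]; exists (g x).
- by move=> i i' _ _ [x [[_ <-] [_ <-]]].
- move=> i _; have [Fi|/eqP/set0P[x [Ax fx]]] := pselect (F i = set0).
    by exists (y i); split; [exact: (yF i).1 | exact: gy].
  have Fi : F i !=set0 by exists x.
  have pk z : A z -> f z = i -> (i = j -> z = y i) -> g z = i.
    move=> Az fz zy; rewrite /g; case: pickP => [i' /asboolP[zi' Fi'0]|//].
    have ij : i = j by rewrite -fz zi'; exact: (yF i').2.
    have : y i' = y i by rewrite -zi' zy.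
    by move=> /y_inj.
  have [ij|ij] := eqVneq i j.
    by exists (y i); split; [exact: (yF i).1 | apply: pk => //; rewrite ij; case: (yF j)].
  by exists x; split=> //; apply: pk => // ij'; rewrite ij' eqxx in ij.
- move=> i; have [Fi|/eqP/set0P Fi] := pselect (F i = set0).
    exists j => x [Ax gx].
    move: gx; rewrite /g; case: pickP => [i' /asboolP[-> _] _|_ fx].
      by have [Ay <-] := yF i'; exact: fU.
    by have : F i x by []; rewrite Fi.
  by exists i => x [Ax gx]; rewrite -gx gf ?gx//; exact: fU.
Qed.

Lemma infinite_itvcc (R : realType) (a b : R) : a < b -> infinite_set `[a, b].
Proof.
move=> ab /finite_seqP[s Es].
(* More points of the interval than entries of the list. *)
pose x i : R := a + (b - a) / i.+1%:R.
have xs : {subset mkseq x (size s).+1 <= s}.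
  move=> _ /mapP[i _ ->]; suff : `[a, b]%classic (x i) by rewrite Es.
  have i1 : 1 <= i.+1%:R :> R by rewrite ler1n.
  have ba0 : 0 <= b - a by rewrite subr_ge0 ltW.
  have h0 : 0 <= (b - a) / i.+1%:R by rewrite divr_ge0.
  have h1 : (b - a) / i.+1%:R <= b - a.
    by rewrite ler_pdivrMr ?(lt_le_trans ltr01)// ler_peMr.
  have : a <= x i <= b.
    by move: h0 h1; rewrite /x; set q := _ / _ => ? ?; apply/andP; split; lra.
  by rewrite /= in_itv.
have : uniq (mkseq x (size s).+1).
  apply/mkseq_uniqP => i j _ _ /addrI/(mulfI _) h.
  have /invr_inj/eqP : i.+1%:R^-1 = j.+1%:R^-1 :> R.
    by apply: h; rewrite subr_eq0 gt_eqF.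
  by rewrite eqr_nat => /eqP[].
by move=> /uniq_leq_size/(_ xs); rewrite size_mkseq ltnn.
Qed.

Variables (R : realType) (d : nat).
Implicit Types (c g : R -> 'rV[R]_d) (a b t u v x : R) (k n : nat).

(** Some coordinate takes two values on the segment, hence infinitely many. *)
Lemma infinite_image_segment g a b : a <= b -> continuous g -> g a != g b ->
  infinite_set (g @` `[a, b]).
Proof.
move=> ab cg gab fin.
have [i gi] : exists i, g a ord0 i != g b ord0 i.
  apply: contrapT => no; move/eqP: gab; apply; apply/rowP => i.
  by apply: contrapT => /eqP h; apply: no; exists i.
pose f t := g t ord0 i.
have cf : continuous f.
  move=> t; apply: (@continuous_comp _ _ _ g (fun M : 'rV[R]_d => M ord0 i)).
    exact: cg.
  exact: coord_continuous.
have : finite_set ((fun M : 'rV[R]_d => M ord0 i) @` (g @` `[a, b])).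
  exact: finite_image.
have fab : Num.min (f a) (f b) < Num.max (f a) (f b).
  by rewrite /f; case: (ltgtP (g a ord0 i) (g b ord0 i)) gi => //= ->; rewrite eqxx.
apply/contra_not: (infinite_itvcc fab); apply: sub_finite_set => w /=.
rewrite in_itv/= => hw.
have [t tab <-] := IVT ab (continuous_subspaceT cf) hw.
by exists (g t) => //; exists t.
Qed.

Lemma infinite_trace c : (0 < curve_length c)%E ->
  forall g (L : R), (forall u v, u <= v ->
      eucl_dist (g u) (g v) <= L * (v - u)) ->
    g @` `[0, 1] = trace c -> infinite_set (trace c).
Proof.
move=> c0 g L lip gc.
have cg := lipschitz_continuous lip.
have [t [t0 t1 gt]] : exists t, [/\ 0 <= t, t <= 1 & g 0 != g t].
  apply: contrapT => no; move: c0; apply/negP; rewrite -leNgt.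
  have gE t : 0 <= t <= 1 -> c t = g 0.
    move=> t01; have : trace c (c t) by exists t => //=; rewrite in_itv.
    rewrite -gc => -[u /=]; rewrite in_itv/= => /andP[u0 u1] <-.
    apply: contrapT => /eqP gu; apply: no; exists u; split=> //.
    by rewrite eq_sym.
  have := @curve_length_le _ _ c (fun=> 0); rewrite subrr; apply=> u v u0 uv v1.
  rewrite !gE ?eucl_distxx ?subrr// ?u0 ?v1 ?andbT.
    exact: le_trans u0 uv.
  exact: le_trans uv v1.
rewrite -gc => fin; apply: (infinite_image_segment t0 cg gt).
apply: sub_finite_set fin => _ [u /= + <-]; rewrite in_itv/= => /andP[u0 ut].
by exists u => //=; rewrite in_itv/= u0 (le_trans ut).
Qed.

Lemma periodic_int g (m : int) u : (forall v, g (v + 1) = g v) ->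
  g (u + m%:~R) = g u.
Proof.
move=> g1.
have gn (n : nat) v : g (v + n%:R) = g v.
  elim: n => [|n IH]; first by rewrite addr0.
  by rewrite -natr1 addrA g1.
case: m => n; first by rewrite gn.
by rewrite NegzE mulrNz -[LHS](gn n.+1) -[_ n.+1%:Z]/n.+1%:R subrK.
Qed.

Lemma consecutive_arcs_cover g (tau : nat -> R) k :
  (forall u, g (u + 1) = g u) -> tau 0%N + 1 <= tau k ->
  g @` `[0, 1] `<=` \bigcup_(i : 'I_k) (g @` `[tau i, tau i.+1]).
Proof.
move=> g1 tauk _ [u _ <-].
pose v := u - (Num.floor (u - tau 0%N))%:~R.
have gv : g v = g u by rewrite -(periodic_int (Num.floor (u - tau 0%N)) v g1) subrK.
have /andP[v0 v1] : tau 0%N <= v <= tau 0%N + 1.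
  have := floor_itv (u - tau 0%N); rewrite intrD1 => /andP[? ?].
  by rewrite /v; apply/andP; split; lra.
suff [i ik iv] : exists2 i, (i < k)%N & tau i <= v <= tau i.+1.
  by exists (Ordinal ik) => //; exists v => //=; rewrite in_itv.
have : v <= tau k by exact: le_trans v1 tauk.
case: k tauk => [|k] tauk; first by lra.
elim: k {tauk} => [|k IH] vk; first by exists 0%N; rewrite ?v0.
have [/IH[i ik iv]|/ltW kv] := leP v (tau k.+1); last by exists k.+1; rewrite ?kv.
by exists i => //; exact: ltnW.
Qed.

(** Arcs that go once around the curve may overlap or retrace each other; the
    trace is infinite, so the cover still refines to [k] non-empty sets. *)
Lemma gamma_le c g (L T : R) (tau : nat -> R) k :
  closed_curve c -> curve_length c = L%:E -> 0 < L ->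
  (forall u v, u <= v -> eucl_dist (g u) (g v) <= L * (v - u)) ->
  (forall u, g (u + 1) = g u) -> g @` `[0, 1] = trace c ->
  tau 0%N + 1 <= tau k ->
  (forall i, (i < k)%N -> tau i <= tau i.+1 /\
    L * (tau i.+1 - tau i) + eucl_dist (g (tau i)) (g (tau i.+1)) <= T * L) ->
  (gamma c k <= T%:E)%E.
Proof.
move=> cc cL L0 lip g1 gc tauk arcs.
have tr_inf : infinite_set (trace c).
  by apply: (infinite_trace _ lip gc); rewrite cL lte_fin.
have [|S [part_S sub_S]] := @cover_refine_partition _ k
  (fun i => g @` `[tau i, tau i.+1]) _ tr_inf.
  by rewrite -gc; exact: consecutive_arcs_cover.
have tourS i : (tour_length (S i) <= (T * L)%:E)%E.
  have [j Sij] := sub_S i; have [tj wj] := arcs j (ltn_ord j).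
  by apply: (le_trans (tour_length_arc lip tj Sij)); rewrite lee_fin.
apply: (@le_trans _ _ ((\big[maxe/-oo%E]_(i < k) tour_length (S i))
    / curve_length c)%E).
  by apply: ereal_inf_lbound; exists S.
rewrite cL inver gt_eqF// lee_pdivrMr// -EFinM.
elim/big_ind: _ => [|x y hx hy|i _]; [exact: leNye | | exact: tourS].
by rewrite ge_max hx.
Qed.

End Coverings.

(** * Short chords and the balancing of arcs *)

Section Balancing.
Variables (R : realType) (d : nat).
Implicit Types (g : R -> 'rV[R]_d) (k N : nat).

(** With [x = pi / (3 k)] this is [sin (3 x) / (3 sin x)]: in a regular
    [3 k]-gon, the chord over three sides divided by the length of the three
    sides. *)
Definition chord_ratio k : R := (1 + 2 * cos (angle R (3 * k) 1)) / 3.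

(** [sum_sqr_increment3] applied to each coordinate of the division points, whose
    successive distances are at most [L / N]. *)
Lemma sum_sqr_chord3 g (L : R) N :
  (4 <= N)%N ->
  (forall u v, u <= v -> eucl_dist (g u) (g v) <= L * (v - u)) ->
  (forall u, g (u + 1) = g u) ->
  \sum_(i < N) eucl_dist (g (i%:R / N%:R)) (g ((i + 3)%:R / N%:R)) ^+ 2 <=
  (1 + 2 * cos (angle R N 1)) ^+ 2 * (L ^+ 2 / N%:R).
Proof.
move=> N4 lip g1.
have N0 : (0 < N)%N by exact: leq_trans N4.
have Np : 0 < N%:R :> R by rewrite ltr0n.
have z0 := cos_angle1_ge0 R N4; set z := cos _ in z0 *.
pose P (l : 'I_d) i := g (i%:R / N%:R) ord0 l.
have perP l i : P l (i + N)%N = P l i.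
  by rewrite /P natrD mulrDl divff ?gt_eqF// g1.
have E m : \sum_(i < N) eucl_dist (g (i%:R / N%:R)) (g ((i + m)%:R / N%:R)) ^+ 2
    = \sum_(l < d) \sum_(i < N) (P l (i + m)%N - P l i) ^+ 2.
  rewrite exchange_big /=; apply: eq_bigr => i _.
  by rewrite eucl_distC eucl_distE sqr_enorm; apply: eq_bigr => l _; rewrite !mxE.
rewrite E; apply: (@le_trans _ _ ((1 + 2 * z) ^+ 2 *
    \sum_(l < d) \sum_(i < N) (P l (i + 1)%N - P l i) ^+ 2)).
  by rewrite mulr_sumr; apply: ler_sum => l _; exact: sum_sqr_increment3.
rewrite ler_wpM2l ?sqr_ge0// -E.
apply: (@le_trans _ _ (\sum_(i < N) (L / N%:R) ^+ 2)); last first.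
  rewrite sumr_const card_ord -[leLHS]mulr_natl.
  by rewrite (_ : _ * _ = L ^+ 2 / N%:R)//; field; rewrite gt_eqF.
apply: ler_sum => i _.
have h : eucl_dist (g (i%:R / N%:R)) (g ((i + 1)%:R / N%:R)) <= L / N%:R.
  apply: le_trans (lip _ _ _) _.
    by rewrite ler_pM2r ?invr_gt0// ler_nat leq_addr.
  by rewrite -mulrBl natrD addrC addKr mul1r.
by rewrite ler_pXn2r ?nnegrE ?eucl_dist_ge0// (le_trans (eucl_dist_ge0 _ _) h).
Qed.

(** The mean over the [3 k] division points of the left-hand side is at most the
    right-hand side. *)
Lemma two_short_chords g (L : R) k : (2 <= k)%N ->
  (forall u v, u <= v -> eucl_dist (g u) (g v) <= L * (v - u)) ->
  (forall u, g (u + 1) = g u) ->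
  exists t, eucl_dist (g t) (g (t + k%:R^-1)) ^+ 2 +
    eucl_dist (g (t + k%:R^-1)) (g (t + 2 / k%:R)) ^+ 2 <=
    2 * (chord_ratio k * L / k%:R) ^+ 2.
Proof.
move=> k2 lip g1; pose N := (3 * k)%N.
have k0 : 0 < k%:R :> R by rewrite ltr0n (leq_trans _ k2).
have N4 : (4 <= N)%N by rewrite (@leq_trans (3 * 2))// leq_mul2l.
have N0 : (0 < N)%N by exact: leq_trans N4.
have Np : 0 < N%:R :> R by rewrite ltr0n.
pose f i := eucl_dist (g (i%:R / N%:R)) (g ((i + 3)%:R / N%:R)) ^+ 2.
have perf i : f (i + N)%N = f i.
  by rewrite /f addnAC !(natrD _ _ N) !mulrDl divff ?gt_eqF// !g1.
have fE (i j : nat) : (j = i + 3)%N -> j%:R / N%:R = i%:R / N%:R + k%:R^-1 :> R.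
  by move=> ->; rewrite /N natrD natrM; field; rewrite gt_eqF.
have N3 : N%:R = 3 * k%:R :> R by rewrite natrM.
apply: contrapT => no.
have : \sum_(i < N) (f i + f (i + 3)%N) <= N%:R * (2 * (chord_ratio k * L / k%:R) ^+ 2).
  rewrite big_split /= (sum_periodic_shift 3 perf) -mulr2n -[leLHS]mulr_natl.
  rewrite [leRHS]mulrCA ler_pM2l// (le_trans (sum_sqr_chord3 N4 lip g1))//.
  rewrite le_eqVlt; apply/orP; left; apply/eqP.
  by rewrite /chord_ratio -/N N3; field; rewrite gt_eqF.
apply/negP; rewrite -ltNge.
rewrite (_ : _ * _ = \sum_(i < N) (2 * (chord_ratio k * L / k%:R) ^+ 2)); last first.
  by rewrite sumr_const card_ord -[RHS]mulr_natl.
apply: ltr_sum; first by apply/hasP; exists (Ordinal N0) => //; exact: mem_index_enum.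
move=> i _; rewrite ltNge; apply/negP => h; apply: no; exists (i%:R / N%:R).
move: h; rewrite /f (fE i (i + 3)%N)// (fE (i + 3)%N (i + 3 + 3)%N)// (fE i (i + 3)%N)//.
by rewrite -addrA (_ : k%:R^-1 + k%:R^-1 = 2 / k%:R)//; ring.
Qed.

(** For the target [T = 2 / k - e / k ^+ 2], [k] arcs of length [T / 2] miss a
    length [e / (2 k)] of the normalized curve.  A chord over [1 / k] of length
    at most [(1 - e) / k] lets one arc gain all of it; if neither of two adjacent
    chords is that short, the hypothesis on [e] makes both at most
    [(1 - e / 2) / k], which lets each of the two arcs gain half of it. *)
Lemma gamma_sup_le k (e : R) : (3 <= k)%N -> 0 <= e <= 1 ->
  2 * chord_ratio k ^+ 2 <= (1 - e) ^+ 2 + (1 - e / 2) ^+ 2 ->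
  (gamma_sup R d k <= (2 / k%:R - e / k%:R ^+ 2)%:E)%E.
Proof.
move=> k3 /andP[e0 e1] ratio; apply: ge_ereal_sup => _ [c [cc /andP[c0 c1]] <-].
have [L cL] : exists L, curve_length c = L%:E.
  by exists (fine (curve_length c)); rewrite fineK// ge0_fin_numE// ltW.
have L0 : 0 < L by move: c0; rewrite cL lte_fin.
have [g [lip g1 gc]] := lipschitz_reparametrization cc cL.
have k3R : 3 <= k%:R :> R by rewrite ler_nat.
have k0 : 0 < k%:R :> R by lra.
pose w : R := k%:R^-1.
have kw : k%:R * w = 1 by rewrite divff// gt_eqF.
have w0 : 0 < w by rewrite invr_gt0.
have w3 : w <= 1 / 3 by rewrite div1r lef_pV2 ?posrE//; lra.
pose T := 2 * w - e * w ^+ 2.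
have -> : 2 / k%:R - e / k%:R ^+ 2 = T by rewrite /T /w exprVn.
have ew : e * w ^+ 2 <= w / 3.
  have : e * w ^+ 2 <= 1 * w ^+ 2 by rewrite ler_wpM2r ?sqr_ge0.
  have : w * w <= w * (1 / 3) by rewrite ler_wpM2l// ltW.
  rewrite -expr2; lra.
have ew0 : 0 <= e * w ^+ 2 by rewrite mulr_ge0 ?sqr_ge0.
have ke : k%:R * (e * w ^+ 2) = e * w.
  by rewrite expr2 [e * _]mulrC !mulrA kw mul1r mulrC.
have arc u v : u <= v -> v - u <= T / 2 ->
    u <= v /\ L * (v - u) + eucl_dist (g u) (g v) <= T * L.
  move=> uv vu; split=> //; have := lip _ _ uv.
  by have := ler_wpM2l (ltW L0) vu; lra.
have T0 : 0 <= T / 2 by rewrite /T; lra.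
have stepE (j : nat) (s : R) : s + j.+1%:R * (T / 2) - (s + j%:R * (T / 2)) = T / 2.
  by rewrite -natr1; ring.
(* One arc of length [a = 1 - (k - 1) T / 2], all others of length [T / 2]. *)
pose a := w + (k%:R - 1) * (e * w ^+ 2) / 2.
have aw : w <= a.
  by rewrite /a lerDl divr_ge0// mulr_ge0//; lra.
have one_chord t : eucl_dist (g t) (g (t + w)) <= (1 - e) * w * L ->
    (gamma c k <= T%:E)%E.
  move=> ht; pose tau i := if i is j.+1 then t + a + j%:R * (T / 2) else t.
  apply: (@gamma_le _ _ c g L T tau) => //.
    have : tau k = t + a + (k%:R - 1) * (T / 2).
      by case: (k) k3 => [|j]// _; rewrite /= -natr1; ring.
    move=> ->; rewrite /=.
    by rewrite /a /T; lra.
  case=> [_|i _] /=; last first.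
    by apply: arc; [rewrite -subr_ge0 stepE | rewrite stepE].
  rewrite mul0r addr0; split; first by lra.
  have h2 : eucl_dist (g (t + w)) (g (t + a)) <= L * (a - w).
    by rewrite (le_trans (lip _ _ _)) ?lerD2l//; lra.
  have := eucl_dist_triangle (g (t + w)) (g t) (g (t + a)).
  have -> : T * L = L * a + (1 - e) * w * L + L * (a - w).
    rewrite (_ : T = a + (1 - e) * w + (a - w)); first by ring.
    by rewrite /a /T; lra.
  by lra.
have [t ht] := two_short_chords (ltnW k3) lip g1.
rewrite -/w in ht.
have [|s1] := lerP (eucl_dist (g t) (g (t + w))) ((1 - e) * w * L).
  exact: one_chord.
have tw : t + w + w = t + 2 * w by ring.
have [|s2] := lerP (eucl_dist (g (t + w)) (g (t + 2 * w))) ((1 - e) * w * L).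
  by rewrite -tw; exact: one_chord.
(* Each of the two arcs is extended by [x] at its free end, up to the common
   length [(1 - (k - 2) T / 2) / 2]. *)
pose x := (k%:R - 2) * (e * w ^+ 2) / 4.
have x0 : 0 <= x by rewrite /x divr_ge0// mulr_ge0//; lra.
have hB : eucl_dist (g t) (g (t + w)) <= (1 - e / 2) * w * L /\
    eucl_dist (g (t + w)) (g (t + 2 * w)) <= (1 - e / 2) * w * L.
  move: ht s1 s2; set D1 := eucl_dist _ _; set D2 := eucl_dist _ _ => ht s1 s2.
  have wL : 0 <= w * L by rewrite mulr_ge0// ltW.
  have sq D D' : (1 - e) * w * L < D' -> 0 <= D ->
      D ^+ 2 + D' ^+ 2 <= 2 * (chord_ratio k * L * w) ^+ 2 ->
      D <= (1 - e / 2) * w * L.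
    move=> sD' D0 h; rewrite leNgt; apply/negP => sD.
    have p0 : 0 <= (1 - e) * w * L by rewrite -mulrA mulr_ge0//; lra.
    have q0 : 0 <= (1 - e / 2) * w * L by rewrite -mulrA mulr_ge0//; lra.
    have hD' : ((1 - e) * w * L) ^+ 2 < D' ^+ 2.
      by rewrite ltr_pXn2r ?nnegrE// (le_trans p0)// ltW.
    have hD : ((1 - e / 2) * w * L) ^+ 2 < D ^+ 2 by rewrite ltr_pXn2r ?nnegrE.
    have := ler_wpM2r (sqr_ge0 (w * L)) ratio.
    have -> : 2 * chord_ratio k ^+ 2 * (w * L) ^+ 2 =
      2 * (chord_ratio k * L * w) ^+ 2 by ring.
    have -> : ((1 - e) ^+ 2 + (1 - e / 2) ^+ 2) * (w * L) ^+ 2 =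
      ((1 - e) * w * L) ^+ 2 + ((1 - e / 2) * w * L) ^+ 2 by ring.
    by lra.
  split; first by apply: (sq _ D2) => //; exact: eucl_dist_ge0.
  by apply: (sq _ D1); rewrite ?eucl_dist_ge0// addrC.
have [hB1 hB2] := hB.
pose tau i := match i with 0 => t - x | 1 => t + w
  | j.+2 => t + 2 * w + x + j%:R * (T / 2) end.
apply: (@gamma_le _ _ c g L T tau) => //.
  have : tau k = t + 2 * w + x + (k%:R - 2) * (T / 2).
    by case: (k) k3 => [|[|j]]// _; rewrite /= -!natr1; ring.
  move=> ->; rewrite /=.
  by rewrite /x /T; lra.
have TL : T * L = L * (w + x) + (1 - e / 2) * w * L + L * x.
  rewrite (_ : T = w + x + (1 - e / 2) * w + x); first by ring.
  by rewrite /x /T; lra.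
case=> [|[|i]] _ /=; last first.
- by apply: arc; [rewrite -subr_ge0 stepE | rewrite stepE].
- rewrite mul0r addr0; split; first by lra.
  have h2 : eucl_dist (g (t + 2 * w)) (g (t + 2 * w + x)) <= L * x.
    by rewrite (le_trans (lip _ _ _)) ?lerDl// addrC addKr.
  have := eucl_dist_triangle (g (t + 2 * w)) (g (t + w)) (g (t + 2 * w + x)).
  by rewrite TL; lra.
- split; first by lra.
  have h2 : eucl_dist (g (t - x)) (g t) <= L * x.
    by rewrite (le_trans (lip _ _ _)) ?lerBlDr ?lerDl// opprB addrC subrK.
  have := eucl_dist_triangle (g t) (g (t - x)) (g (t + w)).
  by rewrite TL; lra.
Qed.

Lemma chord_ratio_ge0 k : (2 <= k)%N -> 0 <= chord_ratio k.
Proof.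
move=> k2; have : 0 <= cos (angle R (3 * k) 1).
  by apply: cos_angle1_ge0; rewrite (@leq_trans (3 * 2))// leq_mul2l.
by rewrite /chord_ratio; lra.
Qed.

Lemma chord_ratio_le k : (2 <= k)%N -> chord_ratio k <= 1 - 4 / (3 * k%:R ^+ 2).
Proof.
move=> k2; have := @cos_angle1_le R (3 * k).
rewrite (@leq_trans (3 * 2))// ?leq_mul2l// => /(_ isT).
have k0 : 0 < k%:R :> R by rewrite ltr0n (leq_trans _ k2).
have -> : 18 / (3 * k)%:R ^+ 2 = 2 / k%:R ^+ 2 :> R.
  by rewrite natrM; field; rewrite gt_eqF.
have -> : 4 / (3 * k%:R ^+ 2) = 4 / 3 * k%:R ^- 2 :> R.
  by field; rewrite gt_eqF.
by rewrite /chord_ratio; lra.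
Qed.

Lemma chord_ratio3_le : chord_ratio 3 <= 847 / 1000.
Proof.
have := cos_angle9_le R; rewrite /chord_ratio; change (3 * 3)%N with 9%N.
by set z := cos _; lra.
Qed.

Lemma gamma_sup_le_bound k (e r T : R) : (3 <= k)%N -> 0 <= e <= 1 ->
  chord_ratio k <= r -> 2 * r ^+ 2 <= (1 - e) ^+ 2 + (1 - e / 2) ^+ 2 ->
  2 / k%:R - e / k%:R ^+ 2 <= T -> (gamma_sup R d k <= T%:E)%E.
Proof.
move=> k3 e01 kr hr kT; apply: (@le_trans _ _ (2 / k%:R - e / k%:R ^+ 2)%:E).
  apply: gamma_sup_le => //; apply: le_trans hr; rewrite ler_pM2l//.
  have c0 := chord_ratio_ge0 (ltnW k3).
  by rewrite ler_pXn2r ?nnegrE// (le_trans c0).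
by rewrite lee_fin.
Qed.

End Balancing.

Theorem theorem3 (R : realType) :
  (forall d k : nat, (2 <= d)%N -> (3 <= k)%N ->
     (gamma_sup R d k <= (2 / k%:R - 1 / (4 * k%:R ^+ 4))%:E)%E) /\
  (forall d : nat, (2 <= d)%N ->
     (gamma_sup R d 3 <= (644 / 1000)%:E)%E /\
     (gamma_sup R d 4 <= (494 / 1000)%:E)%E /\
     (gamma_sup R d 5 <= (398 / 1000)%:E)%E /\
     (gamma_sup R d 6 <= (333 / 1000)%:E)%E /\
     (gamma_sup R d 7 <= (285 / 1000)%:E)%E /\
     (gamma_sup R d 8 <= (250 / 1000)%:E)%E /\
     (gamma_sup R d 9 <= (222 / 1000)%:E)%E /\
     (gamma_sup R d 10 <= (200 / 1000)%:E)%E).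
Proof.
split=> [d k _ k3|d _].
  have k3R : 3 <= k%:R :> R by rewrite ler_nat.
  have k0 : 0 < k%:R :> R by lra.
  pose y : R := k%:R ^- 2.
  have y0 : 0 < y by rewrite invr_gt0 exprn_gt0.
  have y9 : y <= 1 / 9.
    by rewrite /y div1r lef_pV2 ?posrE ?exprn_gt0//; nra.
  apply: (@gamma_sup_le_bound _ _ k (y / 4) (1 - 4 / (3 * k%:R ^+ 2))) => //.
  - by apply/andP; split; lra.
  - exact: chord_ratio_le (ltnW k3).
  - have -> : 4 / (3 * k%:R ^+ 2) = 4 / 3 * y.
      by rewrite /y; field; rewrite gt_eqF.
    nra.
  - rewrite (_ : 1 / _ = y / 4 / k%:R ^+ 2)// /y; field; by rewrite gt_eqF.
(* The values [e = k ^+ 2 * (2 / k - T)] are dictated by the targets [T]. *)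
have small k (e T : R) : (3 <= k)%N -> 0 <= e <= 1 ->
    2 * (1 - 4 / (3 * k%:R ^+ 2)) ^+ 2 <= (1 - e) ^+ 2 + (1 - e / 2) ^+ 2 ->
    2 / k%:R - e / k%:R ^+ 2 <= T -> (gamma_sup R d k <= T%:E)%E.
  by move=> k3 e01; apply: gamma_sup_le_bound => //; exact: chord_ratio_le (ltnW k3).
split.
  apply: (@gamma_sup_le_bound _ _ 3 (204 / 1000) (847 / 1000)) => //; try lra.
  exact: chord_ratio3_le.
split; first by apply: (small 4 (96 / 1000)) => //; lra.
split; first by apply: (small 5 (50 / 1000)) => //; lra.
split; first by apply: (small 6 (12 / 1000)) => //; lra.
split; first by apply: (small 7 (35 / 1000)) => //; lra.
split; first by apply: (small 8 0) => //; lra.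
split; first by apply: (small 9 (18 / 1000)) => //; lra.
by apply: (small 10 0) => //; lra.
Qed.
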